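(* Let $p$ be a prime power and let $n$ be a positive integer. If there exists a weighing matrix $W(n,p)$, then for every positive integer $m$ there exists a weighing matrix $$W\left(\frac{p^{m+1}-1}{p-1}(n-1)+1,\; p^{m+1}\right).$$
   Context: A weighing matrix of order $n$ and weight $k$, denoted $W(n,k)$, is an $n\times n$ matrix $W$ with entries in $\{0,1,-1\}$ such that $WW^t = kI_n$. *)

(* Defs.v *)
From mathcomp Require Import all_boot all_order all_algebra.

Set Implicit Arguments.
Unset Strict Implicit.
Unset Printing Implicit Defensive.

Import GRing.Theory Num.Theory.
Local Open Scope ring_scope.

(* The exponent is at least 1, so 1 is not a prime power. *)
Definition prime_power (p : nat) : Prop :=
  exists q r : nat, [/\ prime q, (0 < r)%N & p = (q ^ r)%N].

Definition weighing_matrix (n k : nat) (W : 'M[int]_n) : Prop :=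
  (forall i j : 'I_n, W i j \in [:: 0; 1; -1]) /\ W *m W^T = (k%:R)%:M.

(* Main.v *)
(** Odd [p]: bring the given matrix to the form [[1 A] [0 B]], where [A] has [p]
    rows indexed by the field [F] with [p] elements. For a vector [v] of
    [F^(m+1)], put side by side the rows of [A] with indices [v . y], for [y]
    ranging over the points of PG(m, p), and prepend an entry 1. Two codewords
    of the simplex code agree on just enough points to make these [p^(m+1)]
    rows orthogonal. The remaining rows are those of the Kronecker product of
    [B] with the matrix [chi (x . y)] over PG(m, p), where [chi] is the
    quadratic character, prepended with an entry 0.

    Even [p]: [chi] does not exist, but Hadamard matrices of order [p^m] do.
    The order [n_m] satisfies
    [n_m = n_(m-1) + (n - 1) p^m = n + (n_(m-1) - 1) p],
    so the weighing matrices W(n_(m-1), p^m) and W(p^m, p^m) can be woven with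
    W(n, p) and W(p, p) along a 0/1 matrix having these row and column sums. *)

Require Import Defs.
From mathcomp Require Import all_boot all_order all_algebra all_field.
From mathcomp Require Import zify ring.

Set Implicit Arguments.
Unset Strict Implicit.
Unset Printing Implicit Defensive.

Import Order.TTheory GRing.Theory Num.Theory.

Section Weighing.

Local Open Scope ring_scope.

(** * Weighing matrices indexed by finite sets, and weaving *)

Definition trit (x : int) : bool := x \in [:: 0; 1; -1].

(** Rows and columns have separate index sets, so that vectors, points and cells can index a matrix
    directly; [weighing_of_fun] asks only that the two sets have equal size. *)
Definition row_orthogonal (I J : finType) (D : {set I}) (E : {set J})
    (k : nat) (f : I -> J -> int) : Prop :=
  {in D &, forall i i', \sum_(j in E) f i j * f i' j = k%:R * (i == i')%:R}.

Definition weighing (n k : nat) : Prop :=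
  exists W : 'M[int]_n, weighing_matrix k W.

Lemma tritP (x : int) : reflect [\/ x = 0, x = 1 | x = -1] (trit x).
Proof.
rewrite /trit !inE; apply: (iffP or3P) => [[] /eqP|[] ->]; rewrite ?eqxx.
- by constructor 1.
- by constructor 2.
- by constructor 3.
- by constructor 1.
- by constructor 2.
- by constructor 3.
Qed.

Lemma trit_mul (x y : int) : trit x -> trit y -> trit (x * y).
Proof. by move=> /tritP[] -> /tritP[] ->. Qed.

Lemma trit_sqr (x : int) : trit x -> x * x = (x != 0)%:R.
Proof. by move=> /tritP[] ->. Qed.

Lemma weighing_of_fun (I J : finType) (D : {set I}) (E : {set J}) (n k : nat)
    (f : I -> J -> int) :
  (forall i j, trit (f i j)) -> row_orthogonal D E k f ->
  #|D| = n -> #|E| = n -> weighing n k.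
Proof.
move=> f3 fo cD cE; subst n.
exists (\matrix_(i, j) f (enum_val i) (enum_val (cast_ord (esym cE) j))).
split=> [i j|]; first by rewrite mxE; apply: f3.
apply/matrixP=> i i'; rewrite !mxE.
under eq_bigr do rewrite !mxE.
rewrite -(inj_eq enum_val_inj) -[RHS]mulr_natr.
rewrite -[RHS]fo ?enum_valP //.
rewrite [RHS]big_enum_val (reindex (cast_ord (esym cE))) //=.
by exists (cast_ord cE) => x _; rewrite ?cast_ordK ?cast_ordKV.
Qed.

(** Extension by 0 outside [D] lets [weaving] sum over a whole type although its index sets vary. *)
Lemma fun_of_weighing (I : finType) (D : {set I}) (n k : nat) :
  #|D| = n -> weighing n k ->
  exists f : I -> I -> int, [/\ forall i j, trit (f i j),
    forall i j, ~~ ((i \in D) && (j \in D)) -> f i j = 0 & row_orthogonal D D k f].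
Proof.
move=> cD [W [W3 WW]]; subst n.
have [D0|[x0 Dx0]] := set_0Vmem D.
  exists (fun _ _ => 0); split=> // i i'; by rewrite D0 inE.
pose r := enum_rank_in Dx0.
exists (fun i j => if (i \in D) && (j \in D) then W (r i) (r j) else 0).
split=> [i j|i j /negPf -> //|i i' Di Di'].
  by case: ifP => // _; apply: W3.
have /matrixP/(_ (r i) (r i')) := WW; rewrite !mxE => WWi.
transitivity (\sum_j W (r i) j * W^T j (r i')).
  rewrite big_enum_val; apply: eq_bigr => j _.
  by rewrite Di Di' enum_valP mxE /r enum_valK_in.
rewrite WWi -[LHS]mulr_natr -(inj_eq enum_val_inj).
by rewrite !enum_rankK_in.
Qed.

(* Craigen's weaving: the product of the block sum of the matrices attached to
   the rows of [M] and the block sum of those attached to its columns.  A row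
   and a column of [M] meet in at most one cell, so no two nonzero terms are
   ever added up. *)
Lemma weaving (R S : finType) (M : R -> S -> bool) (a b : nat) :
  (forall i, weighing #|[set j | M i j]| a) ->
  (forall j, weighing #|[set i | M i j]| b) ->
  weighing (\sum_i #|[set j | M i j]|)%N (a * b).
Proof.
move=> wr wc.
have /fin_all_exists[g gP] i := fun_of_weighing (erefl _) (wr i).
have /fin_all_exists[h hP] j := fun_of_weighing (erefl _) (wc j).
pose C := [set x : R * S | M x.1 x.2].
have cC : #|C| = (\sum_i #|[set j | M i j]|)%N.
  rewrite -sum1_card (eq_bigl (fun x => true && M x.1 x.2)) => [|x]; last first.
    by rewrite inE.
  rewrite -(pair_big_dep xpredT M (fun _ _ => 1%N)) /=.
  by apply: eq_bigr => i _; rewrite -sum1_card; apply: eq_bigl => j; rewrite inE.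
apply: (@weighing_of_fun _ _ C C _ _
  (fun x y => g x.1 x.2 y.2 * h y.2 x.1 y.1)) => //.
  move=> x y; apply: trit_mul; first by case: (gP x.1).
  by case: (hP y.2).
move=> [i j] [i' j']; rewrite !inE /= => Mij Mij'.
rewrite (eq_bigl (fun x => true && M x.1 x.2)) => [|x]; last by rewrite inE.
rewrite -(pair_big_dep xpredT M
  (fun k l => (g i j l * h l i k) * (g i' j' l * h l i' k))) /=.
rewrite (exchange_big_dep xpredT) //=.
(* For fixed [l] the sum over [k] is the inner product of rows [i] and [i'] of [h l], which forces
   [i = i']; the sum over [l] that remains is one for [g i]. Where [(i, l)] or [(i', l)] is not a
   cell of [M], a factor [g] is 0. *)
transitivity (\sum_l (b%:R * (i == i')%:R) * (g i j l * g i' j' l)).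
  apply: eq_bigr => l _.
  have [_ h0 ho] := hP l; have [_ g0 _] := gP i; have [_ g0' _] := gP i'.
  have [Mil|Mil] := boolP (M i l); last first.
    rewrite (g0 j l) ?inE ?(negPf Mil) ?andbF // !mul0r mulr0.
    by rewrite big1 // => k _; rewrite !mul0r.
  have [Mil'|Mil'] := boolP (M i' l); last first.
    rewrite (g0' j' l) ?inE ?(negPf Mil') ?andbF // !mulr0.
    by rewrite big1 // => k _; rewrite mul0r mulr0.
  rewrite -ho ?inE // mulr_suml; apply: eq_big => [k|k _]; first by rewrite inE.
  by ring.
rewrite -mulr_sumr xpair_eqE.
case: eqP => [ii'|_] /=; last by rewrite !mulr0 mul0r.
subst i'; have [_ g0 go] := gP i.
rewrite mulr1 natrM (mulrC a%:R) -mulrA -go ?inE //; congr (_ * _).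
rewrite [RHS]big_mkcond /=; apply: eq_bigr => l _.
by rewrite inE; case: ifP => // Mil; rewrite g0 ?mul0r // !inE Mil andbF.
Qed.

(** Weaving along the all-ones matrix. *)
Lemma weighing_kronecker (m n a b : nat) :
  weighing m a -> weighing n b -> weighing (n * m) (a * b).
Proof.
move=> wm wn.
have := @weaving 'I_n 'I_m (fun _ _ => true) a b.
have cT k (P : pred 'I_k) : P =1 xpredT -> #|[set i | P i]| = k.
  by move=> PT; rewrite cardsE (eq_card PT) card_ord.
rewrite (eq_bigr (fun=> m)) => [|i _]; last by rewrite cT.
rewrite sum_nat_const card_ord => w.
by apply: w => ?; rewrite cT.
Qed.

(** * The extension for even p *)

Lemma weighing_hadamard2 : weighing 2 2.
Proof.
apply: (@weighing_of_fun bool bool setT setT _ _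
          (fun x y => if x && y then -1 else 1)) => [[] []|x y _ _||] //.
- rewrite (eq_bigl xpredT) => [|i]; last by rewrite inE.
  by rewrite big_bool; case: x y => [] [].
- by rewrite cardsT card_bool.
- by rewrite cardsT card_bool.
Qed.

Lemma weighing_sylvester (a : nat) : weighing (2 ^ a) (2 ^ a).
Proof.
elim: a => [|a IHa]; last first.
  by rewrite {1}expnS expnSr; apply: weighing_kronecker => //; apply: weighing_hadamard2.
exists 1%:M; split=> [i j|]; last by rewrite trmx1 mulmx1.
by rewrite mxE; case: eqP.
Qed.

Lemma weighing_weight_le (n k : nat) : (0 < n)%N -> weighing n k -> (k <= n)%N.
Proof.
case: n => // n _ [W [W3 /matrixP/(_ ord0 ord0)]]; rewrite !mxE eqxx mulr1n.
rewrite (eq_bigr (fun j => (W ord0 j != 0)%:R)) => [|j _]; last first.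
  by rewrite mxE trit_sqr //; apply: W3.
rewrite -natr_sum => /eqP; rewrite eqr_nat => /eqP <-.
rewrite -[X in (_ <= X)%N]card_ord -sum1_card leq_sum // => i _.
exact: leq_b1.
Qed.

Lemma geometric_quotientS (p m : nat) : (1 < p)%N ->
  ((p ^ m.+1 - 1) %/ (p - 1) = p ^ m + (p ^ m - 1) %/ (p - 1))%N.
Proof.
move=> p1; rewrite -divnMDl ?subn_gt0 //; congr (_ %/ _)%N.
have := expn_gt0 p m; rewrite expnSr; nia.
Qed.

Lemma geometric_quotientK (p m : nat) : (1 < p)%N ->
  (((p ^ m - 1) %/ (p - 1)) * (p - 1) = p ^ m - 1)%N.
Proof.
move=> p1; elim: m => [|m IHm]; first by rewrite expn0 subnn div0n.
rewrite geometric_quotientS // mulnDl IHm.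
have := expn_gt0 p m; rewrite expnSr; nia.
Qed.

Lemma card_set_sum (I J : finType) (P : pred (I + J)) :
  #|[set x | P x]| = (#|[set i | P (inl i)]| + #|[set j | P (inr j)]|)%N.
Proof. by rewrite -!sum1_card !(eq_bigl _ _ (in_set _)) big_sumType. Qed.

Lemma weighing_weave_step (n p N a : nat) :
  (0 < n)%N -> (1 < p <= n)%N -> weighing n p -> weighing p p ->
  weighing (N * (n - 1) + 1) a -> weighing (N * (p - 1) + 1) a ->
  weighing ((N * p + 1) * (n - 1) + 1) (a * p).
Proof.
case: n => // d _ /andP[p1 pn] wn wp; rewrite !subSS !subn0 => wNd wNp.
case: d pn wn wNd => [|d] pn wn wNd; first lia.
(* [M] has a full first row and a full first column; the rest is [N] copies, side by side, of a
   circulant matrix of order n - 1 with p - 1 ones in each row and column. *)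
pose M (i : unit + 'I_d.+1) (j : unit + 'I_N * 'I_d.+1) : bool :=
  match i, j with
  | inr i, inr (_, j) => (nat_of_ord (j - i)%R < p - 1)%N
  | _, _ => true
  end.
have ce (e : nat) : (e <= d.+1)%N -> #|[set t : 'I_d.+1 | (t < e)%N]| = e.
  move=> ed; rewrite -sum1_card (eq_bigl _ _ (in_set _)).
  by rewrite -(big_ord_widen _ (fun=> 1%N)) // sum1_card card_ord.
have c1 (i : 'I_d.+1) : #|[set j | (nat_of_ord (j - i)%R < p - 1)%N]| = (p - 1)%N.
  rewrite -[RHS]ce; last lia.
  rewrite -(card_preimset _ (addIr (- i))); apply: eq_card => j; by rewrite !inE.
have c2 (j : 'I_d.+1) : #|[set i | (nat_of_ord (j - i)%R < p - 1)%N]| = (p - 1)%N.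
  rewrite -[RHS]ce; last lia.
  rewrite -(card_preimset _ (inj_comp (addrI j) oppr_inj)).
  by apply: eq_card => i; rewrite !inE.
have cT (T : finType) (P : pred T) : P =1 xpredT -> #|[set x | P x]| = #|T|.
  by move=> PT; rewrite cardsE; apply: eq_card.
have rows1 : #|[set j | M (inl tt) j]| = (N * d.+1 + 1)%N.
  by rewrite cT // card_sum card_unit card_prod !card_ord addnC.
have rows i : #|[set j | M (inr i) j]| = (N * (p - 1) + 1)%N.
  rewrite card_set_sum cT // card_unit addnC; congr (_ + _)%N.
  rewrite -[RHS](f_equal2 muln (card_ord N) (c1 i)) -cardsT -cardsX.
  by apply: eq_card => -[y j]; rewrite !inE.
have cols1 : #|[set i | M i (inl tt)]| = d.+2.
  by rewrite cT ?card_sum ?card_unit ?card_ord // => -[].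
have cols y j : #|[set i | M i (inr (y, j))]| = p.
  by rewrite card_set_sum cT // card_unit c2; lia.
have -> : ((N * p + 1) * d.+1 + 1 = \sum_i #|[set j | M i j]|)%N.
  rewrite big_sumType /= (big_pred1 tt) => [|[]] //; rewrite rows1 (eq_bigr _ (fun i _ => rows i)).
  by rewrite sum_nat_const card_ord; nia.
apply: weaving => [[[]|i]|[[]|[y j]]].
- by rewrite rows1.
- by rewrite rows.
- by rewrite cols1.
- by rewrite cols.
Qed.

Lemma weighing_extension_even (r n m : nat) : (0 < r)%N -> (0 < n)%N ->
  weighing n (2 ^ r) ->
  weighing (((2 ^ r) ^ m.+1 - 1) %/ (2 ^ r - 1) * (n - 1) + 1) ((2 ^ r) ^ m.+1).
Proof.
move=> r0 n0 wn; have pn := weighing_weight_le n0 wn.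
have p1 : (1 < 2 ^ r)%N by rewrite -{1}(expn0 2) ltn_exp2l.
elim: m => [|m IHm].
  by rewrite expn1 divnn subn_gt0 p1 mul1n subnK.
have -> : (((2 ^ r) ^ m.+2 - 1) %/ (2 ^ r - 1) =
           (((2 ^ r) ^ m.+1 - 1) %/ (2 ^ r - 1)) * 2 ^ r + 1)%N.
  have := geometric_quotientK m.+1 p1; have := geometric_quotientS m.+1 p1.
  have : (0 < (2 ^ r) ^ m.+1)%N by rewrite expn_gt0 expn_gt0.
  by nia.
rewrite [X in weighing _ X]expnSr.
apply: weighing_weave_step => //; first by rewrite p1.
  exact: weighing_sylvester.
(* With [N] = (p^(m+1) - 1)/(p - 1), the order N (p - 1) + 1 is p^(m+1), a power of 2. *)
rewrite geometric_quotientK // subnK ?expn_gt0 ?expn_gt0 // -expnM.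
exact: weighing_sylvester.
Qed.

(** * Derived and residual parts of a weighing matrix *)

Lemma weighing_matrix_tr (n k : nat) (W : 'M[int]_n) :
  (0 < k)%N -> weighing_matrix k W -> W^T *m W = (k%:R)%:M.
Proof.
move=> k0 [_ WW]; pose V := map_mx (intr : int -> rat) W.
have k0' : k%:R != 0 :> rat by rewrite pnatr_eq0 -lt0n.
have VV : V *m V^T = (k%:R)%:M.
  by rewrite map_trmx -map_mxM WW map_scalar_mx /= rmorph_nat.
(* Over the field [rat] a right inverse of a square matrix is also a left inverse. *)
have : V *m (k%:R^-1 *: V^T) = 1%:M.
  by rewrite -scalemxAr VV scale_scalar_mx mulVf.
move/mulmx1C; rewrite -scalemxAl => /(congr1 ( *:%R k%:R)).
rewrite scalerA divff // scale1r scale_scalar_mx mulr1 => VV'.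
apply/matrixP=> i j; apply: (intr_inj (R := rat)).
have : map_mx intr (W^T *m W) = map_mx intr (k%:R)%:M :> 'M[rat]_n.
  by rewrite map_mxM -map_trmx VV' map_scalar_mx; congr _%:M; rewrite /= rmorph_nat.
by move/matrixP/(_ i j); rewrite ![map_mx _ _ _ _]mxE.
Qed.

(* [A] and [B] are the derived and residual parts of a weighing matrix whose
   rows have been ordered and signed so that its first column is 1, ..., 1,
   0, ..., 0. *)
Lemma weighing_derived_residual (F : finType) (n : nat) :
  (0 < #|F|)%N -> (0 < n)%N -> weighing n #|F| ->
  exists (A : F -> 'I_n -> int) (B : 'I_n -> 'I_n -> int) (E K : {set 'I_n}),
  [/\ #|E| = (n - 1)%N /\ #|K| = (n - #|F|)%N,
      (forall a j, trit (A a j)) /\ (forall i j, trit (B i j)),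
      forall a b, \sum_(j in E) A a j * A b j = #|F|%:R * (a == b)%:R - 1,
      forall a i, i \in K -> \sum_(j in E) A a j * B i j = 0 &
      row_orthogonal K E #|F| B].
Proof.
case: n => // n p0 _ [W wW]; have [W3 WW] := wW.
have {}W3 i j : trit (W i j) by apply: W3.
pose D := [set i | W i ord0 != 0]; pose E : {set 'I_n.+1} := ~: [set ord0].
(* The columns have squared norm [#|F|] too, which counts the nonzero entries of column 0. *)
have cD : #|D| = #|F|.
  have /matrixP/(_ ord0 ord0) := weighing_matrix_tr p0 wW.
  rewrite !mxE eqxx mulr1n (eq_bigr (fun i => (W i ord0 != 0)%:R)) => [|i _].
    rewrite -natr_sum => /eqP; rewrite eqr_nat => /eqP <-.
    by rewrite -big_mkcond sum1_card cardsE.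
  by rewrite mxE trit_sqr.
have WE i i' : \sum_(j in E) W i j * W i' j =
    #|F|%:R * (i == i')%:R - W i ord0 * W i' ord0.
  have /matrixP/(_ i i') := WW; rewrite !mxE -[X in _ = X -> _]mulr_natr => <-.
  rewrite [in RHS](bigD1 ord0) //= mxE addrAC subrr add0r.
  by apply: eq_big => j; rewrite ?inE // mxE.
pose e (a : F) := enum_val (cast_ord (esym cD) (enum_rank a)).
have eD a : W (e a) ord0 != 0.
  by have := enum_valP (cast_ord (esym cD) (enum_rank a)); rewrite inE.
have e_inj : injective e.
  by move=> a b /enum_val_inj/cast_ord_inj/enum_rank_inj.
have sq a : W (e a) ord0 * W (e a) ord0 = 1 by rewrite trit_sqr // eD.
exists (fun a j => W (e a) ord0 * W (e a) j), W, E, (~: D); split.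
- by split; rewrite cardsCs setCK ?cards1 ?cD card_ord.
- by split=> // a j; apply: trit_mul.
- move=> a b; under eq_bigr do rewrite mulrACA.
  rewrite -mulr_sumr WE (inj_eq e_inj) mulrBr [X in _ - X]mulrACA !sq mulr1.
  by case: eqP => [->|_]; rewrite ?sq ?mul1r // !mulr0.
- move=> a i; rewrite !inE negbK => /eqP Wi0.
  under eq_bigr do rewrite -mulrA.
  rewrite -mulr_sumr WE Wi0 mulr0 subr0; case: eqP => [eai|_]; last by rewrite !mulr0.
  by have := eD a; rewrite eai Wi0 eqxx.
- move=> i i'; rewrite !inE !negbK => /eqP Wi0 _.
  by rewrite WE Wi0 mul0r subr0.
Qed.

(** * Sums over the points of a projective space *)

Section Projective.

Variables (F : finFieldType) (d : nat).
Local Notation V := 'rV[F]_d.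
Local Notation q := #|F|.

Definition dot (u v : V) : F := (u *m v^T) 0 0.

Lemma dotDr u v w : dot u (v + w) = dot u v + dot u w.
Proof. by rewrite /dot linearD mulmxDr mxE. Qed.

Lemma dotZr c u v : dot u (c *: v) = c * dot u v.
Proof. by rewrite /dot linearZ -scalemxAr mxE. Qed.

Lemma dotBl u v w : dot (u - v) w = dot u w - dot v w.
Proof. by rewrite /dot mulmxBl !mxE. Qed.

(** The columns of [cokermx w] are orthogonal to [w], and some column is not orthogonal to [u]. *)
Lemma dot_separating (u w : V) : ~~ (u <= w)%MS ->
  exists2 z, dot u z = 1 & dot w z = 0.
Proof.
rewrite submxE => /rV0Pn[j uj].
set c := (u *m cokermx w) 0 j in uj.
exists (c^-1 *: (col j (cokermx w))^T); rewrite dotZr /dot trmxK colE mulmxA -colE mxE.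
  by rewrite mulVf.
by rewrite mulmx_coker mxE mulr0.
Qed.

(** Translating [v] by [t *: z] adds [t] to [dot u v] and fixes [dot w v]; summing over [t] turns
    the first argument into a free variable. *)
Lemma sum_dot_free (u w : V) (g : F -> F -> int) : ~~ (u <= w)%MS ->
  q%:R * (\sum_v g (dot u v) (dot w v)) = \sum_v \sum_t g t (dot w v).
Proof.
move=> /dot_separating[z uz wz].
have shift t : \sum_v g (dot u v) (dot w v) = \sum_v g (dot u v + t) (dot w v).
  rewrite (reindex_inj (addIr (t *: z))); apply: eq_bigr => v _.
  by rewrite !dotDr !dotZr uz wz mulr1 mulr0 addr0.
transitivity (\sum_(t : F) \sum_v g (dot u v) (dot w v)).
  by rewrite sumr_const mulr_natl.
rewrite (eq_bigr _ (fun t _ => shift t)) exchange_big; apply: eq_bigr => v _.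
by rewrite [RHS](reindex_inj (addrI (dot u v))).
Qed.

Lemma sum_dot (u : V) (g : F -> int) : u != 0 ->
  q%:R * (\sum_v g (dot u v)) = q%:R ^+ d * \sum_t g t.
Proof.
move=> u0; rewrite (@sum_dot_free u 0 (fun t _ => g t)); last first.
  by apply: contra u0 => /sub_rVP[a ->]; rewrite scaler0.
by rewrite sumr_const -natrX [RHS]mulr_natl card_mx mul1n.
Qed.

(** A projective point is encoded by one chosen generator. The [pick] depends only on the span of
    [v], and its default is never reached because [v] itself qualifies. *)
Definition point_rep (v : V) : V := odflt v [pick x | <<x>>%MS == <<v>>%MS].

Definition points : {set V} := [set v | (v != 0) && (point_rep v == v)].

Lemma genmx_point_rep v : <<point_rep v>>%MS = <<v>>%MS.
Proof. by rewrite /point_rep; case: pickP => [x /eqP|]. Qed.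

Lemma eq_point_rep u v : <<u>>%MS = <<v>>%MS -> point_rep u = point_rep v.
Proof. by move=> uv; rewrite /point_rep uv; case: pickP => // /(_ v); rewrite eqxx. Qed.

Lemma genmx_scale c v : c != 0 -> <<(c *: v : V)>>%MS = <<v>>%MS.
Proof. by move=> c0; apply/genmxP/eqmxP/eqmx_scale. Qed.

Lemma point_rep_neq0 v : v != 0 -> point_rep v != 0.
Proof.
by rewrite -!submx0 => v0; rewrite -genmxE genmx_point_rep genmxE.
Qed.

Lemma sub_point_rep v : (v <= point_rep v)%MS.
Proof. by rewrite -(genmxE (point_rep v)) genmx_point_rep genmxE. Qed.

Lemma point_rep_in v : v != 0 -> point_rep v \in points.
Proof.
move=> v0; rewrite inE point_rep_neq0 //=.
by rewrite (eq_point_rep (genmx_point_rep v)).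
Qed.

Lemma points_sub_eq x y : x \in points -> y \in points -> (x <= y)%MS -> x = y.
Proof.
rewrite !inE => /andP[x0 /eqP rx] /andP[_ /eqP ry] /sub_rVP[c xc].
rewrite -rx -ry; apply: eq_point_rep; rewrite xc genmx_scale //.
by apply: contraNneq x0 => c0; rewrite xc c0 scale0r.
Qed.

Lemma card_point_fibre y : y \in points ->
  #|[set v | (v != 0) && (point_rep v == y)]| = q.-1.
Proof.
rewrite inE => /andP[y0 /eqP ry].
rewrite -(cardC1 (0 : F)) -(card_imset _ (_ : injective (fun c => c *: y))); last first.
  by move=> c c' /eqP; rewrite -subr_eq0 -scalerBl scaler_eq0 (negPf y0) orbF subr_eq0 => /eqP.
apply: eq_card => v; rewrite inE; apply/andP/imsetP => [[v0 /eqP rv]|[c c0 ->]].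
  have : (v <= y)%MS by rewrite -rv sub_point_rep.
  case/sub_rVP=> c vc; exists c => //; rewrite inE.
  by apply: contraNneq v0 => c0; rewrite vc c0 scale0r.
rewrite !inE in c0; rewrite scaler_eq0 negb_or c0 y0; split=> //.
by rewrite (eq_point_rep (genmx_scale _ c0)) ry.
Qed.

(** Each point accounts for the q - 1 nonzero multiples of its representative. *)
Lemma sum_points (f : V -> int) :
  (forall c v, c != 0 -> f (c *: v) = f v) ->
  \sum_(v | v != 0) f v = q.-1%:R * \sum_(y in points) f y.
Proof.
move=> fZ; rewrite (partition_big point_rep (mem points)) => [|v]; last exact: point_rep_in.
rewrite mulr_sumr; apply: eq_bigr => y Py.
rewrite -(card_point_fibre Py) mulr_natl -sumr_const.
apply: eq_big => [v|v /andP[v0 /eqP rv]]; first by rewrite inE.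
have : (v <= y)%MS by rewrite -rv sub_point_rep.
case/sub_rVP=> c vc; rewrite vc fZ //.
by apply: contraNneq v0 => c0; rewrite vc c0 scale0r.
Qed.

Lemma card_points : (#|points| * q.-1 = q ^ d - 1)%N.
Proof.
have := @sum_points (fun=> 1) (fun _ _ _ => erefl); rewrite !sumr_const cardC1.
rewrite card_mx mul1n -natrM => /eqP; by rewrite eqr_nat => /eqP; rewrite mulnC subn1 => ->.
Qed.

(* Distinct codewords of the simplex code agree on (q^(d-1) - 1)/(q - 1) of the
   (q^d - 1)/(q - 1) points. *)
Lemma simplex_agreement (u v : V) : u != v ->
  \sum_(y in points) (q%:R * (dot u y == dot v y)%:R - 1) = -1 :> int.
Proof.
move=> uv; have w0 : u - v != 0 by rewrite subr_eq0.
pose f y : int := q%:R * (dot u y == dot v y)%:R - 1.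
have fE y : f y = q%:R * (dot (u - v) y == 0)%:R - 1 by rewrite /f dotBl subr_eq0.
have q1 : (1 < q)%N := card_finNzRing_gt1 F.
(* [dot (u - v) y] takes each value equally often. Removing the term q - 1 at [y = 0] leaves -(q -
   1) over the nonzero vectors, hence -1 over the points. *)
have sum0 : \sum_y f y = 0.
  apply: (@mulfI _ q%:R); first by rewrite pnatr_eq0; lia.
  rewrite mulr0 (eq_bigr _ (fun y _ => fE y)).
  rewrite (sum_dot (fun t => q%:R * (t == 0)%:R - 1 : int) w0).
  rewrite sumrB sumr_const -mulr_sumr (bigD1 0) //= big1 => [|t /negPf-> //].
  by rewrite eqxx addr0 mulr1 subrr mulr0.
apply: (@mulfI _ q.-1%:R); first by rewrite pnatr_eq0; lia.
rewrite -(@sum_points f) => [|c y c0]; last by rewrite !fE dotZr mulf_eq0 (negPf c0).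
rewrite (bigD1 0) //= fE /dot trmx0 mulmx0 mxE eqxx mulr1 in sum0.
move/eqP: sum0; rewrite addrC addr_eq0 => /eqP ->.
by rewrite mulrN1 -subn1 natrB // ltnW.
Qed.

End Projective.

(** * The quadratic character and its matrix over the points *)

Section QuadraticCharacter.

Variable F : finFieldType.
Local Notation q := #|F|.

(** Euler's criterion serves as the definition, since powers are multiplicative; for odd [q], [q./2]
    is (q - 1)/2. *)
Definition qchar (x : F) : int :=
  if x == 0 then 0 else if x ^+ q./2 == 1 then 1 else -1.

Lemma qchar_trit x : trit (qchar x).
Proof. by rewrite /qchar; case: ifP => // _; case: ifP. Qed.

Lemma qchar_eq0 x : (qchar x == 0) = (x == 0).
Proof. by rewrite /qchar; case: ifP => // _; case: ifP. Qed.

Hypothesis q_odd : odd q.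

Lemma expf_half (x : F) : x != 0 -> (x ^+ q./2 == 1) || (x ^+ q./2 == -1).
Proof.
move=> x0; rewrite -sqrf_eq1 -exprM; apply/eqP; apply: (mulfI x0).
rewrite -exprS mulr1 -[RHS]expf_card; congr (_ ^+ _).
by rewrite -[RHS]odd_double_half q_odd muln2.
Qed.

(** Otherwise X^(q./2) - 1 would have q - 1 roots, more than its degree. *)
Lemma expf_half_neq1 : exists2 z : F, z != 0 & z ^+ q./2 != 1.
Proof.
have q1 : (1 < q)%N := card_finNzRing_gt1 F.
suff /exists_inP[z z0 zN] : [exists (z | z != 0 :> F), z ^+ q./2 != 1] by exists z.
rewrite -[X in is_true X]negbK negb_exists_in; apply/negP => /forall_inP all1.
pose P : {poly F} := 'X^(q./2) - 1%:P.
have sP : size P = (q./2).+1 by rewrite size_XnsubC //; lia.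
have cF : size (enum [pred x : F | x != 0%R]) = q.-1 by rewrite -cardE cardC1.
have : (size (enum [pred x : F | x != 0%R]) < size P)%N.
  apply: max_poly_roots; first by rewrite -size_poly_eq0 sP.
    apply/allP => x; rewrite mem_enum inE => x0.
    rewrite rootE !hornerE subr_eq0.
    by have := all1 x x0; rewrite negbK.
  exact: enum_uniq.
rewrite sP cF; lia.
Qed.

Lemma oneN_neq1 : (-1 : F) != 1.
Proof.
have [z z0 zN] := expf_half_neq1.
by case/orP: (expf_half z0) => /eqP zE; rewrite zE ?eqxx in zN.
Qed.

Lemma qcharM x y : qchar (x * y) = qchar x * qchar y.
Proof.
rewrite /qchar mulf_eq0; case: eqP => [|/eqP x0] /=; first by rewrite mul0r.
case: eqP => [|/eqP y0] /=; first by rewrite mulr0.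
rewrite exprMn; case/orP: (expf_half x0) => /eqP ->; case/orP: (expf_half y0) => /eqP ->.
all: by rewrite ?mulN1r ?mul1r ?opprK ?eqxx ?(negPf oneN_neq1).
Qed.

Lemma sum_qchar : \sum_x qchar x = 0.
Proof.
have [z z0 zN] := expf_half_neq1.
have qz : qchar z = -1 by rewrite /qchar (negPf z0) (negPf zN).
have : \sum_x qchar x = - \sum_x qchar x.
  rewrite {1}(reindex_inj (mulfI z0)) -sumrN.
  by apply: eq_bigr => x _; rewrite qcharM qz mulN1r.
lia.
Qed.

Lemma sum_qchar_sqr : \sum_x qchar x * qchar x = q.-1%:R.
Proof.
rewrite (eq_bigr (fun x => (x != 0)%:R)) => [|x _].
  by rewrite -natr_sum -big_mkcond sum1_card -(cardC1 (0 : F)).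
by rewrite trit_sqr ?qchar_trit // qchar_eq0.
Qed.

Variable m : nat.

(** Scaling [y] by [c] multiplies the product of two entries by the square of [qchar c], so the sum
    can be taken over all vectors. For distinct points the two dot products are independent, and
    [qchar] sums to 0. *)
Lemma qchar_points_orthogonal :
  row_orthogonal (points F m.+1) (points F m.+1) (q ^ m) (fun x y => qchar (dot x y)).
Proof.
have q1 : (1 < q)%N := card_finNzRing_gt1 F.
move=> x y Px Py.
have q0 (k : nat) : (0 < k)%N -> (k%:R : int) != 0 by rewrite pnatr_eq0 lt0n.
have qd0 : q.-1%:R != 0 :> int by apply: q0; lia.
have qq0 : q%:R != 0 :> int by apply: q0; lia.
have dot0 (u : 'rV[F]_m.+1) : dot u 0 = 0 by rewrite /dot trmx0 mulmx0 mxE.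
apply: (mulfI qd0); rewrite -sum_points => [|c v c0]; last first.
  by rewrite !dotZr !qcharM mulrACA trit_sqr ?qchar_trit // qchar_eq0 c0 mul1r.
transitivity (\sum_v qchar (dot x v) * qchar (dot y v)).
  by rewrite [RHS](bigD1 0) //= dot0 /qchar eqxx mul0r add0r.
apply: (mulfI qq0); case: eqP => [<-|/eqP xy].
  rewrite (sum_dot (fun t => qchar t * qchar t)); last by move: Px; rewrite inE => /andP[].
  by rewrite sum_qchar_sqr natrX exprS mulr1; ring.
rewrite (@sum_dot_free _ _ x y (fun s t => qchar s * qchar t)); last first.
  by apply: contra xy => /(points_sub_eq Px Py)/eqP.
by rewrite big1 ?mulr0 // => v _; rewrite -mulr_suml sum_qchar mul0r.
Qed.

End QuadraticCharacter.

(** * The extension for odd p *)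

Lemma weighing_extension_odd (F : finFieldType) (n m : nat) :
  odd #|F| -> (0 < n)%N -> weighing n #|F| ->
  weighing ((#|F| ^ m.+1 - 1) %/ (#|F| - 1) * (n - 1) + 1) (#|F| ^ m.+1).
Proof.
set q := #|F|; move=> q_odd n0 wn.
have q1 : (1 < q)%N := card_finNzRing_gt1 F.
have qn := weighing_weight_le n0 wn.
have [A [B [E [K [[cE cK] [A3 B3] AA AB BB]]]]] :=
  weighing_derived_residual (ltnW q1 : (0 < #|F|)%N) n0 wn.
pose V := 'rV[F]_m.+1; pose P : {set V} := points F m.+1.
have cP : ((q ^ m.+1 - 1) %/ (q - 1) = #|P|)%N.
  rewrite -(card_points F m.+1) -/q -/P -subn1 mulnK //; lia.
have cPq : (#|P| * (q - 1) = q ^ m.+1 - 1)%N by rewrite subn1 card_points.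
have qm0 : (0 < q ^ m.+1)%N by rewrite expn_gt0 (ltnW q1).
pose f (x : V + V * 'I_n) (y : unit + V * 'I_n) : int :=
  match x, y with
  | inl v, inl _ => 1
  | inl v, inr (y, j) => A (dot v y) j
  | inr _, inl _ => 0
  | inr (x, i), inr (y, j) => qchar (dot x y) * B i j
  end.
pose R : {set V + V * 'I_n} := [set x | if x is inr x' then x' \in setX P K else true].
pose C : {set unit + V * 'I_n} := [set x | if x is inr x' then x' \in setX P E else true].
have sumC (g : unit + V * 'I_n -> int) : \sum_(y in C) g y =
    g (inl tt) + \sum_(y in P) \sum_(j in E) g (inr (y, j)).
  rewrite big_sumType /= (big_pred1 tt) => [|[]]; last by rewrite inE.
  rewrite pair_big; congr (_ + _); apply: eq_big => [[y j]|[y j] _] //.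
  by rewrite !inE.
rewrite cP; apply: (@weighing_of_fun _ _ R C _ _ f).
- by move=> [v|[x i]] [u|[y j]] //=; apply: trit_mul => //; apply: qchar_trit.
- have ortho v x i : (x, i) \in setX P K -> \sum_(y in C) f (inl v) y * f (inr (x, i)) y = 0.
    rewrite inE /= => /andP[_ Ki]; rewrite sumC /= mulr0 add0r big1 // => y _.
    under eq_bigr do rewrite mulrCA.
    by rewrite -mulr_sumr AB // mulr0.
  move=> [v|[x i]] [v'|[x' i']]; rewrite !inE => Rx Rx'.
  (* For distinct [v] and [v'] the simplex code contributes -1, which cancels the leading 1; for
     equal ones the sum is 1 + [#|P|] (q - 1) = q^(m+1). *)
  + rewrite sumC /= mulr1 (eq_bigr _ (fun y _ => AA _ _)).
    have -> : (inl v == inl v' :> V + V * 'I_n) = (v == v') by [].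
    case: eqP => [->|/eqP vv']; last first.
      by rewrite simplex_agreement // mulr0 subrr.
    under eq_bigr do rewrite eqxx mulr1.
    rewrite sumr_const mulr1 -[X in 1 + X]mulr_natr -(natrB _ (ltnW q1)).
    by rewrite -natrM -(natrD _ 1) mulnC cPq; congr _%:R; lia.
  + by rewrite ortho ?inE // mulr0.
  + under eq_bigr do rewrite mulrC.
    by rewrite ortho ?inE // mulr0.
  + move: Rx Rx' => /andP[/= Px Ki] /andP[/= Px' Ki'].
    rewrite sumC /= mul0r add0r.
    transitivity (\sum_(y in P) (qchar (dot x y) * qchar (dot x' y)) * (q%:R * (i == i')%:R)).
      apply: eq_bigr => y _; rewrite -BB // mulr_sumr; apply: eq_bigr => j _; ring.
    rewrite -mulr_suml qchar_points_orthogonal ?inE // -/q expnS natrM.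
    have -> : (inr (x, i) == inr (x', i') :> V + V * 'I_n) = (x == x') && (i == i') by [].
    by case: (x == x'); case: (i == i'); rewrite /= ?mulr0 ?mul0r ?mulr1 // mulrC.
(* The matrix is square: q^(m+1) + [#|P|] (n - q) = 1 + [#|P|] (n - 1). *)
- rewrite /R card_set_sum cardsT card_mx mul1n cardsE cardsX cK -/q.
  have -> : (n - 1 = (n - q) + (q - 1))%N by lia.
  by rewrite mulnDr cPq -addnA subnK // addnC.
- by rewrite /C card_set_sum cardsT card_unit cardsE cardsX cE addnC.
Qed.

End Weighing.

(* The quotient is a division of natural numbers; it is exact because p - 1
   divides p ^ m.+1 - 1, and p - 1 > 0. *)
Theorem theorem4 (p n : nat) (hp : prime_power p) (hn : 0 < n)
    (hW : exists W : 'M[int]_n, weighing_matrix p W) (m : nat) (hm : 0 < m) :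
  exists W : 'M[int]_(((p ^ m.+1 - 1) %/ (p - 1)) * (n - 1) + 1),
    weighing_matrix (p ^ m.+1) W.
Proof.
have [q [r [pr_q r0 pE]]] := hp; subst p.
have [q2|q_odd] := even_prime pr_q; first by subst q; apply: weighing_extension_even.
have [F _ cF] := pPrimePowerField pr_q r0; rewrite -cF in hW *.
by apply: weighing_extension_odd => //; rewrite cF oddX q_odd orbT.
Qed.
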